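(* Let $p,q:[a,\infty)\to(0,\infty)$ be continuous, $a\ge 0$, and consider the equation (A): $(p(t)x')'=q(t)x$. Assume that $\int_a^\infty\frac{dt}{p(t)}=\infty$ and $\int_a^\infty q(t)\,dt<\infty$, and put $P(t)=\int_a^t\frac{ds}{p(s)}$, $\rho(t)=\int_t^\infty q(s)\,ds$. Suppose that $$\int_a^\infty q(t)P(t)\,dt=\infty\qquad\Bigl(\text{or equivalently } \int_a^\infty\frac{\rho(t)}{p(t)}\,dt=\infty\Bigr)$$ and that there is a constant $\delta\in(0,1)$ such that $$\int_t^\infty\frac{\rho(s)^2}{p(s)}\,ds\le\delta\rho(t)\quad\text{for all large } t.$$ Then (A) possesses a positive decaying extreme solution $x(t)$, i.e. a positive solution satisfying $x(\infty)=Dx(\infty)=0$.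
   Context: Solutions of (A) are nontrivial real solutions defined on some interval $[T,\infty)$, $T\ge a$. $Dx(t)=p(t)x'(t)$, $x(\infty)=\lim_{t\to\infty}x(t)$, $Dx(\infty)=\lim_{t\to\infty}Dx(t)$. A solution is extreme if either $|x(\infty)|=|Dx(\infty)|=0$ (decaying) or $|x(\infty)|=|Dx(\infty)|=\infty$ (growing). *)

(* Defs.v *)
From Stdlib Require Import Reals.
From Coquelicot Require Import Coquelicot.
Open Scope R_scope.

(** The half-line [[T, oo)]. *)
Definition ray (T : R) : R -> Prop := fun t => T <= t.

(** [int_a^oo f = oo]; meant for [f] integrable on every [[a, t]], since [RInt]
    is total. *)
Definition RInt_infinite (f : R -> R) (a : R) : Prop :=
  is_lim (fun t => RInt f a t) p_infty p_infty.

Definition ex_RInt_infty (f : R -> R) (a : R) : Prop :=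
  ex_RInt_gen f (at_point a) (Rbar_locally p_infty).

Definition RInt_infty (f : R -> R) (a : R) : R :=
  RInt_gen f (at_point a) (Rbar_locally p_infty).

Definition Pfun (p : R -> R) (a t : R) : R := RInt (fun s => / p s) a t.

Definition rho (q : R -> R) (t : R) : R := RInt_infty q t.

(** [f' = df] on [[T, oo)].  This is [is_derive] with the neighbourhood filter
    restricted to [[T, oo)], so the derivative is one-sided at [T] and values of
    [f] to the left of [T] are irrelevant. *)
Definition derive_on_ray (T : R) (f df : R -> R) : Prop :=
  forall t, T <= t ->
    filterdiff f (within (ray T) (locally t)) (fun h => scal h (df t)).

(** [Dx = p x'], with the derivative [dx] of [x] passed explicitly. *)
Definition quasi_derivative (p dx : R -> R) : R -> R := fun t => p t * dx t.

(** [x], with derivative [dx], is a nontrivial solution of [(p x')' = q x] on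
    [[T, oo)]. *)
Definition is_solution (p q : R -> R) (T : R) (x dx : R -> R) : Prop :=
  derive_on_ray T x dx /\
  derive_on_ray T (quasi_derivative p dx) (fun t => q t * x t) /\
  (exists t, T <= t /\ x t <> 0).

Definition is_decaying_extreme (p x dx : R -> R) : Prop :=
  is_lim x p_infty 0 /\ is_lim (quasi_derivative p dx) p_infty 0.

(* Main.v *)
Require Import Defs.
From Stdlib Require Import Reals Lra Lia.
From Coquelicot Require Import Coquelicot.
Open Scope R_scope.

(** Write [r = 1/p], [P] for the primitive of [r] and [Q] for the primitive of
    [q], both vanishing at [a], so that [rho = Q(oo) - Q].  Equation (A) is the
    system [x' = r z], [z' = q x], where [z = Dx].

    The equivalence of the two divergence conditions is an integration by parts:
    [int_a^t q P = int_a^t r rho - rho(t) P(t)].  Dropping the last term gives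
    one direction.  For the other, fix [t] with [int_a^t r rho] large; beyond [t]
    the integral of [q P] grows by at least [P(t) (Q(s) - Q(t))], which tends to
    [P(t) rho(t)] and so makes up for the subtracted term
    ([divergence_equivalence]).

    A positive decreasing solution is obtained by reduction of order.  Picard
    iteration contracts in a norm weighted by [exp (2 K P)], [K] a bound of [Q],
    which yields a solution [u >= 1] on the whole half-line, with increasing
    positive quasi-derivative [y] ([growing_solution]).  Because [y] increases,
    [r/u^2] is at most [(-1/(y(t) u))'] beyond [t], so
    [int_t^oo r/u^2 <= 1/(y(t) u(t))].  The second solution
    [x(t) = u(t) int_t^oo r/u^2] is therefore well defined and positive, and its
    quasi-derivative [y int_t^oo r/u^2 - 1/u] is at most zero
    ([decreasing_solution]).

    Such a solution decays ([decreasing_solution_decays]).  Its quasi-derivative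
    [z <= 0] increases; were it bounded away from zero, [int r = oo] would drive
    [x] below zero.  Were [x >= eps], then [-z(t) >= eps rho(t)], and
    [int r rho = oo] would again drive [x] below zero. *)

(** * Primitives of continuous functions *)

(** Comparing derivatives instead of integrals: the estimates below become
    pointwise inequalities, with no integrability to check. *)
Lemma increment_le (f g df dg : R -> R) (s t : R) :
  s <= t ->
  (forall x, s <= x <= t -> is_derive f x (df x)) ->
  (forall x, s <= x <= t -> is_derive g x (dg x)) ->
  (forall x, s <= x <= t -> df x <= dg x) ->
  f t - f s <= g t - g s.
Proof.
  intros hst hf hg hle.
  assert (hd : forall x, s <= x <= t ->
            is_derive (fun y => g y - f y) x (dg x - df x)).
  { intros x hx. apply (is_derive_minus g f); auto. }
  destruct (MVT_gen (fun y => g y - f y) s t (fun x => dg x - df x))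
    as [c [hc heq]]; rewrite ?Rmin_left, ?Rmax_right in * by assumption.
  - intros x hx. apply hd; lra.
  - intros x hx. apply continuity_pt_filterlim.
    apply (ex_derive_continuous (fun y => g y - f y)).
    eexists; apply hd; lra.
  - specialize (hle c hc).
    assert (0 <= (dg c - df c) * (t - s)) by (apply Rmult_le_pos; lra).
    lra.
Qed.

Lemma ex_RInt_of_continuous (f : R -> R) (s t : R) :
  (forall x, continuous f x) -> ex_RInt f s t.
Proof. intros hf. apply (ex_RInt_continuous f). auto. Qed.

Lemma is_derive_primitive (f : R -> R) (a t : R) :
  (forall x, continuous f x) -> is_derive (RInt f a) t (f t).
Proof.
  intros hf. apply (is_derive_RInt f (RInt f a) a t); auto.
  apply filter_forall. intros x.
  apply (RInt_correct f). now apply ex_RInt_of_continuous.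
Qed.

Lemma continuous_primitive (f : R -> R) (a t : R) :
  (forall x, continuous f x) -> continuous (RInt f a) t.
Proof.
  intros hf. apply (ex_derive_continuous (RInt f a)).
  eexists. now apply is_derive_primitive.
Qed.

Lemma primitive_incr (f : R -> R) (a s t : R) :
  (forall x, continuous f x) -> (forall x, s <= x <= t -> 0 <= f x) ->
  s <= t -> RInt f a s <= RInt f a t.
Proof.
  intros hf hpos hst.
  assert (h := increment_le (fun _ => 0) (RInt f a) (fun _ => 0) f s t hst).
  assert (0 - 0 <= RInt f a t - RInt f a s); [|lra].
  apply h; auto.
  - intros x _. apply (is_derive_const (V := R_NormedModule)).
  - intros x _. now apply is_derive_primitive.
Qed.

Lemma primitive_point (f : R -> R) (a : R) : RInt f a a = 0.
Proof. apply (RInt_point a f). Qed.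

Lemma continuous_Rmax_l (a t : R) : continuous (Rmax a) t.
Proof.
  apply (continuous_ext (fun x => (a + x + Rabs (a - x)) / 2)).
  - intros x. unfold Rmax, Rabs. destruct (Rle_dec a x), (Rcase_abs (a - x)); lra.
  - apply continuity_pt_filterlim. reg.
Qed.

(** Freezing [f] to the left of [a] turns one-sided continuity at [a] into
    continuity on the whole line, so that two-sided derivatives of primitives
    are available at every point. *)
Lemma continuous_clamp (f : R -> R) (a : R) :
  continuous_on (ray a) f -> forall t, continuous (fun s => f (Rmax a s)) t.
Proof.
  intros hf t. unfold continuous.
  refine (filterlim_comp _ _ _ (Rmax a) f _ _ _ _ (hf (Rmax a t) (Rmax_l _ _))).
  intros P hP. apply (continuous_Rmax_l a t) in hP.
  unfold filtermap in *. revert hP. apply filter_imp. intros x hx. apply hx.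
  apply Rmax_l.
Qed.

(** * Picard iteration in a weighted norm *)

(** Bielecki weight.  The factor 2 is what makes the Picard map contract by 1/2
    on the whole half-line at once, although the primitive of [r] is
    unbounded. *)
Definition weight (r : R -> R) (a K t : R) : R := exp (2 * K * RInt r a t).

(** Integral form of [x' = r z], [z' = q x] with [x a = 1], [z a = 0].  The clamp
    keeps the iterates constant, hence continuous and nonnegative, to the left
    of [a]. *)
Definition picard (r q : R -> R) (a : R) (f : R -> R) (t : R) : R :=
  1 + RInt (fun s => r s * RInt (fun v => q v * f v) a s) a (Rmax a t).

Lemma continuous_mult_fun (f g : R -> R) :
  (forall x, continuous f x) -> (forall x, continuous g x) ->
  forall x, continuous (fun y => f y * g y) x.
Proof. intros hf hg x. now apply (continuous_mult f g). Qed.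

Lemma continuous_picard_kernel (r q : R -> R) (a : R) (f : R -> R) :
  (forall x, continuous r x) -> (forall x, continuous q x) ->
  (forall x, continuous f x) ->
  forall x, continuous (fun s => r s * RInt (fun v => q v * f v) a s) x.
Proof.
  intros hr hq hf. apply continuous_mult_fun; auto.
  intros x. apply continuous_primitive. now apply continuous_mult_fun.
Qed.

Lemma continuous_picard (r q : R -> R) (a : R) (f : R -> R) :
  (forall x, continuous r x) -> (forall x, continuous q x) ->
  (forall x, continuous f x) -> forall t, continuous (picard r q a f) t.
Proof.
  intros hr hq hf t. unfold picard.
  apply (continuous_plus (fun _ => 1)
    (fun t => RInt (fun s => r s * RInt (fun v => q v * f v) a s) a (Rmax a t))).
  - apply continuous_const.
  - apply (continuous_comp (Rmax a)
      (RInt (fun s => r s * RInt (fun v => q v * f v) a s) a)).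
    + apply continuous_Rmax_l.
    + apply continuous_primitive. now apply continuous_picard_kernel.
Qed.

Lemma picard_ge_1 (r q : R -> R) (a : R) (f : R -> R) :
  (forall x, continuous r x) -> (forall x, continuous q x) ->
  (forall x, continuous f x) ->
  (forall x, 0 < r x) -> (forall x, 0 < q x) -> (forall x, 0 <= f x) ->
  forall t, 1 <= picard r q a f t.
Proof.
  intros hr hq hf pr pq pf t. unfold picard.
  enough (RInt (fun s => r s * RInt (fun v => q v * f v) a s) a a <=
    RInt (fun s => r s * RInt (fun v => q v * f v) a s) a (Rmax a t))
    by (rewrite primitive_point in *; lra).
  apply primitive_incr; [now apply continuous_picard_kernel | | apply Rmax_l].
  intros x [hx _]. apply Rmult_le_pos; [now apply Rlt_le|].
  rewrite <- (primitive_point (fun v => q v * f v) a).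
  apply primitive_incr; auto.
  - now apply continuous_mult_fun.
  - intros v _. apply Rmult_le_pos; [now apply Rlt_le | apply pf].
Qed.

Lemma weight_incr (r : R -> R) (a K s t : R) :
  (forall x, continuous r x) -> (forall x, 0 < r x) -> 0 < K -> s <= t ->
  weight r a K s <= weight r a K t.
Proof.
  intros hr pr hK hst. unfold weight.
  assert (RInt r a s <= RInt r a t)
    by (apply primitive_incr; auto; intros; now apply Rlt_le).
  destruct (Rle_lt_or_eq_dec (2 * K * RInt r a s) (2 * K * RInt r a t)) as [h|h].
  - apply Rmult_le_compat_l; lra.
  - now apply Rlt_le, exp_increasing.
  - rewrite h; lra.
Qed.

Lemma weight_ge_1 (r : R -> R) (a K t : R) :
  (forall x, continuous r x) -> (forall x, 0 < r x) -> 0 < K -> a <= t ->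
  1 <= weight r a K t.
Proof.
  intros hr pr hK ht. apply Rle_trans with (weight r a K a).
  - unfold weight. rewrite primitive_point, Rmult_0_r, exp_0. lra.
  - now apply weight_incr.
Qed.

Lemma is_derive_weight (r : R -> R) (a K t : R) :
  (forall x, continuous r x) ->
  is_derive (weight r a K) t (2 * K * r t * weight r a K t).
Proof.
  intros hr. unfold weight.
  assert (h := is_derive_primitive r a t hr).
  revert h. generalize (RInt r a). intros P h. auto_derive.
  - repeat split. now exists (r t).
  - apply is_derive_unique in h. change (Derive (fun x : R => P x) t = r t) in h.
    rewrite h. ring.
Qed.

(** One half of the contraction estimate.  The inner integral of [q (f - g)] is
    at most [c K weight], the weight being increasing, and [K r weight] is the
    derivative of [weight / 2]. *)
Lemma picard_contraction_le (r q : R -> R) (a K c : R) (f g : R -> R) :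
  (forall x, continuous r x) -> (forall x, continuous q x) ->
  (forall x, continuous f x) -> (forall x, continuous g x) ->
  (forall x, 0 < r x) -> (forall x, 0 < q x) ->
  0 < K -> (forall t, a <= t -> RInt q a t <= K) -> 0 <= c ->
  (forall t, a <= t -> f t - g t <= c * weight r a K t) ->
  forall t, a <= t ->
  picard r q a f t - picard r q a g t <= c / 2 * weight r a K t.
Proof.
  intros hr hq hf hg pr pq hK hQ hc hfg t ht.
  assert (inner : forall s, a <= s ->
    RInt (fun v => q v * f v) a s - RInt (fun v => q v * g v) a s
    <= c * weight r a K s * K).
  { intros s hs.
    assert (h := increment_le
      (fun s => RInt (fun v => q v * f v) a s - RInt (fun v => q v * g v) a s)
      (fun v => c * weight r a K s * RInt q a v)
      (fun v => q v * f v - q v * g v) (fun v => c * weight r a K s * q v) a s hs).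
    cbv beta in h. rewrite !primitive_point in h.
    apply Rle_trans with (c * weight r a K s * RInt q a s).
    - match type of h with _ -> _ -> _ -> ?A => enough A by lra end.
      apply h.
      + intros x _. apply (is_derive_minus (RInt (fun v => q v * f v) a)
          (RInt (fun v => q v * g v) a));
        apply (is_derive_primitive (fun v => q v * _ v));
          now apply continuous_mult_fun.
      + intros x _. apply (is_derive_scal (RInt q a)).
        now apply is_derive_primitive.
      + intros x hx. rewrite <- Rmult_minus_distr_l, (Rmult_comm (q x)).
        apply Rmult_le_compat_r; [now apply Rlt_le|].
        apply Rle_trans with (1 := hfg x (proj1 hx)).
        apply Rmult_le_compat_l; auto. apply weight_incr; auto; lra.
    - apply Rmult_le_compat_l; auto. apply Rmult_le_pos; auto.
      apply Rlt_le, exp_pos. }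
  unfold picard. rewrite !Rmax_right by assumption.
  set (F := fun s => r s * RInt (fun v => q v * f v) a s).
  set (G := fun s => r s * RInt (fun v => q v * g v) a s).
  assert (h := increment_le (fun s => RInt F a s - RInt G a s)
    (fun s => c / 2 * weight r a K s) (fun s => F s - G s)
    (fun s => c / 2 * (2 * K * r s * weight r a K s)) a t ht).
  cbv beta in h. rewrite !primitive_point in h.
  assert (hE : 0 <= c / 2 * weight r a K a)
    by (apply Rmult_le_pos; [lra | apply Rlt_le, exp_pos]).
  match type of h with _ -> _ -> _ -> ?A => enough A by lra end.
  apply h.
  - intros x _. apply (is_derive_minus (RInt F a) (RInt G a));
      apply is_derive_primitive; now apply continuous_picard_kernel.
  - intros x _. apply (is_derive_scal (weight r a K)). now apply is_derive_weight.
  - intros x hx. unfold F, G. rewrite <- Rmult_minus_distr_l.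
    replace (c / 2 * (2 * K * r x * weight r a K x))
      with (r x * (c * weight r a K x * K)) by field.
    apply Rmult_le_compat_l; [now apply Rlt_le|]. apply inner, hx.
Qed.

Lemma picard_contraction (r q : R -> R) (a K c : R) (f g : R -> R) :
  (forall x, continuous r x) -> (forall x, continuous q x) ->
  (forall x, continuous f x) -> (forall x, continuous g x) ->
  (forall x, 0 < r x) -> (forall x, 0 < q x) ->
  0 < K -> (forall t, a <= t -> RInt q a t <= K) -> 0 <= c ->
  (forall t, a <= t -> Rabs (f t - g t) <= c * weight r a K t) ->
  forall t, a <= t ->
  Rabs (picard r q a f t - picard r q a g t) <= c / 2 * weight r a K t.
Proof.
  intros hr hq hf hg pr pq hK hQ hc hfg t ht. apply Rabs_le.
  assert (h1 : picard r q a f t - picard r q a g t <= c / 2 * weight r a K t).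
  { apply picard_contraction_le; auto. intros s hs.
    apply Rle_trans with (1 := Rle_abs _); auto. }
  assert (h2 : picard r q a g t - picard r q a f t <= c / 2 * weight r a K t).
  { apply picard_contraction_le; auto. intros s hs.
    apply Rle_trans with (1 := Rle_abs _). rewrite Rabs_minus_sym; auto. }
  lra.
Qed.

Lemma picard_clamp (r q : R -> R) (a : R) (f : R -> R) (t : R) :
  picard r q a f (Rmax a t) = picard r q a f t.
Proof.
  unfold picard. now rewrite (Rmax_right a (Rmax a t)) by apply Rmax_l.
Qed.

Lemma half_pow_small (c eps : R) :
  0 < eps -> 0 < c ->
  exists N : nat, forall n, (N <= n)%nat -> c * (1 / 2) ^ n < eps.
Proof.
  intros he hc.
  destruct (pow_lt_1_zero (1 / 2)) with (y := eps / c) as [N hN].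
  - rewrite Rabs_pos_eq; lra.
  - now apply Rdiv_lt_0_compat.
  - exists N. intros n hn. specialize (hN n hn).
    apply Rle_lt_trans with (c * Rabs ((1/2) ^ n)).
    + apply Rmult_le_compat_l; [lra | apply Rle_abs].
    + apply Rlt_le_trans with (c * (eps / c)); [|right; field; lra].
      now apply Rmult_lt_compat_l.
Qed.

(** Successive iterates from 0 differ by at most [(1/2)^n weight], so they
    converge locally uniformly; the limit is continuous and the contraction
    estimate passes the recursion to the limit. *)
Lemma picard_fixed_point (r q : R -> R) (a K : R) :
  (forall x, continuous r x) -> (forall x, continuous q x) ->
  (forall x, 0 < r x) -> (forall x, 0 < q x) ->
  0 < K -> (forall t, a <= t -> RInt q a t <= K) ->
  exists u : R -> R,
    (forall t, continuous u t) /\ (forall t, 1 <= u t) /\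
    (forall t, u t = picard r q a u t).
Proof.
  intros hr hq pr pq hK hQ.
  set (E := weight r a K).
  assert (posE : forall t, 0 < E t) by (intros; apply exp_pos).
  set (it := fun n => Nat.iter n (picard r q a) (fun _ => 0)).
  assert (it_succ : forall n, it (S n) = picard r q a (it n)) by reflexivity.
  assert (it_cont : forall n t, continuous (it n) t).
  { induction n as [|n IH]; intros t.
    - apply continuous_const.
    - rewrite it_succ. now apply continuous_picard. }
  assert (it_clamp : forall n t, it n (Rmax a t) = it n t).
  { intros [|n] t; [reflexivity|]. rewrite it_succ. apply picard_clamp. }
  assert (it_pos : forall n t, 0 <= it n t).
  { induction n as [|n IH]; intros t.
    - simpl. lra.
    - rewrite it_succ. assert (1 <= picard r q a (it n) t); [|lra].
      now apply picard_ge_1. }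
  assert (it_step : forall n t, a <= t ->
            Rabs (it (S n) t - it n t) <= (1/2) ^ n * E t).
  { induction n as [|n IH]; intros t ht.
    - assert (h : it 1%nat t = 1).
      { unfold it, picard; simpl.
        rewrite (RInt_ext _ (fun _ => 0)), RInt_const.
        - unfold scal; simpl; unfold mult; simpl; ring.
        - intros x _. rewrite (RInt_ext _ (fun _ => 0)), RInt_const.
          + unfold scal; simpl; unfold mult; simpl; ring.
          + intros; simpl; ring. }
      rewrite h. simpl. rewrite Rminus_0_r, Rabs_pos_eq, Rmult_1_l by lra.
      now apply weight_ge_1.
    - replace ((1/2) ^ S n) with ((1/2) ^ n / 2) by (simpl; field).
      apply (picard_contraction r q a K ((1/2) ^ n) (it (S n)) (it n)); auto.
      apply pow_le; lra. }
  (* Keeping the geometric remainder exact makes the induction on [k] go through. *)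
  assert (it_cauchy : forall n k t, a <= t ->
            Rabs (it (n + k)%nat t - it n t) <= 2 * (1/2) ^ n * E t).
  { intros n k t ht.
    enough (Rabs (it (n + k)%nat t - it n t)
              <= (2 * (1/2) ^ n - 2 * (1/2) ^ (n + k)) * E t).
    { apply Rle_trans with (1 := H). apply Rmult_le_compat_r.
      - now apply Rlt_le.
      - assert (0 < (1/2) ^ (n + k)) by (apply pow_lt; lra). lra. }
    induction k as [|k IH].
    - rewrite Nat.add_0_r, !Rminus_diag, Rabs_R0. lra.
    - rewrite Nat.add_succ_r. specialize (it_step (n + k)%nat t ht).
      apply Rle_trans with (Rabs (it (S (n + k)) t - it (n + k)%nat t)
                            + Rabs (it (n + k)%nat t - it n t)).
      + eapply Rle_trans; [right|apply Rabs_triang]. f_equal; ring.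
      + replace ((1/2) ^ S (n + k)) with ((1/2) ^ (n + k) / 2)
          by (simpl; field).
        lra. }
  assert (it_lim : forall t, ex_finite_lim_seq (fun n => it n t)).
  { intros t. apply ex_lim_seq_cauchy_corr. intros eps.
    destruct (half_pow_small (4 * E (Rmax a t)) eps) as [N hN].
    - apply cond_pos.
    - specialize (posE (Rmax a t)). lra.
    - exists N. intros n m hn hm. rewrite <- (it_clamp n t), <- (it_clamp m t).
      assert (hn' := it_cauchy N (n - N)%nat (Rmax a t) (Rmax_l _ _)).
      assert (hm' := it_cauchy N (m - N)%nat (Rmax a t) (Rmax_l _ _)).
      replace (N + (n - N))%nat with n in hn' by lia.
      replace (N + (m - N))%nat with m in hm' by lia.
      specialize (hN N (le_n _)).
      apply Rabs_le_between in hn'. apply Rabs_le_between in hm'.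
      apply Rabs_def1; lra. }
  set (u := fun t => real (Lim_seq (fun n => it n t))).
  assert (u_lim : forall t, is_lim_seq (fun n => it n t) (u t)).
  { intros t. apply Lim_seq_correct', it_lim. }
  assert (u_clamp : forall t, u (Rmax a t) = u t).
  { intros t. unfold u. f_equal. apply Lim_seq_ext. auto. }
  assert (u_near : forall n t, a <= t -> Rabs (u t - it n t) <= 2 * (1/2) ^ n * E t).
  { intros n t ht. apply Rabs_le.
    enough (it n t - 2 * (1/2) ^ n * E t <= u t <= it n t + 2 * (1/2) ^ n * E t) by lra.
    assert (hl := proj1 (is_lim_seq_incr_n _ n _) (u_lim t)).
    assert (hb : forall k, it n t - 2 * (1/2) ^ n * E t <= it (k + n)%nat t
                       <= it n t + 2 * (1/2) ^ n * E t).
    { intros k. specialize (it_cauchy n k t ht). rewrite Nat.add_comm.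
      apply Rabs_le_between in it_cauchy. lra. }
    split.
    - apply (is_lim_seq_le (fun _ => it n t - 2 * (1/2) ^ n * E t)
               (fun k => it (k + n)%nat t) (Finite _) (Finite (u t))); auto.
      + apply hb.
      + apply is_lim_seq_const.
    - apply (is_lim_seq_le (fun k => it (k + n)%nat t)
               (fun _ => it n t + 2 * (1/2) ^ n * E t) (Finite (u t)) (Finite _)); auto.
      + apply hb.
      + apply is_lim_seq_const. }
  (* On a ball of radius 1 around [t] the weight is bounded by its value at
     [t + 1], so the convergence is uniform there. *)
  assert (u_cont : forall t, continuous u t).
  { intros t. apply continuity_pt_filterlim.
    apply (CVU_continuity it u t (mkposreal 1 Rlt_0_1)).
    - intros eps heps.
      destruct (half_pow_small (2 * E (Rmax a (t + 1))) eps) as [N hN]; auto.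
      { specialize (posE (Rmax a (t + 1))). lra. }
      exists N. intros n y hn hy. rewrite <- u_clamp, <- it_clamp.
      apply Rle_lt_trans with (1 := u_near n (Rmax a y) (Rmax_l _ _)).
      apply Rle_lt_trans with (2 := hN n hn).
      replace (2 * E (Rmax a (t + 1)) * (1 / 2) ^ n)
        with (2 * (1 / 2) ^ n * E (Rmax a (t + 1))) by ring.
      apply Rmult_le_compat_l.
      + assert (0 < (1/2) ^ n) by (apply pow_lt; lra). lra.
      + apply weight_incr; auto. unfold Boule in hy; simpl in hy.
        apply Rabs_def2 in hy. apply Rle_max_compat_l. lra.
    - intros n y _. apply continuity_pt_filterlim, it_cont.
    - unfold Boule. rewrite Rminus_diag, Rabs_R0. simpl. lra. }
  assert (u_fix : forall t, u t = picard r q a u t).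
  { intros t. rewrite <- u_clamp, <- picard_clamp.
    set (s := Rmax a t). assert (hs : a <= s) by apply Rmax_l.
    apply cond_eq. intros eps heps.
    destruct (half_pow_small (2 * E s) eps) as [N hN]; auto.
    { specialize (posE s). lra. }
    specialize (hN N (le_n _)).
    assert (h1 := u_near (S N) s hs). rewrite it_succ in h1.
    assert (hp : 0 < (1/2) ^ N) by (apply pow_lt; lra).
    assert (h2 : Rabs (picard r q a u s - picard r q a (it N) s)
                 <= 2 * (1/2) ^ N / 2 * E s).
    { apply picard_contraction; auto. lra. }
    simpl pow in h1. apply Rabs_le_between in h1. apply Rabs_le_between in h2.
    apply Rabs_def1; lra. }
  exists u. split; [assumption|]. split; [|assumption].
  assert (u_pos : forall t, 0 <= u t).
  { intros t. apply (is_lim_seq_le (fun _ => 0) (fun n => it n t) 0 (Finite (u t))); auto.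
    apply is_lim_seq_const. }
  intros t. rewrite u_fix. now apply picard_ge_1.
Qed.

(** * A positive decreasing solution *)

(** The solution with initial data [u a = 1], [y a = 0], where [y] is the
    quasi-derivative. *)
Lemma growing_solution (r q : R -> R) (a K : R) :
  (forall x, continuous r x) -> (forall x, continuous q x) ->
  (forall x, 0 < r x) -> (forall x, 0 < q x) ->
  0 < K -> (forall t, a <= t -> RInt q a t <= K) ->
  exists u y : R -> R,
    (forall t, continuous u t) /\ (forall t, 1 <= u t) /\
    (forall t, a < t -> is_derive u t (r t * y t)) /\
    (forall t, is_derive y t (q t * u t)) /\
    (forall t, a < t -> 0 < y t).
Proof.
  intros hr hq pr pq hK hQ.
  destruct (picard_fixed_point r q a K) as [u [uc [u1 ufix]]]; auto.
  assert (qu_cont : forall x, continuous (fun v => q v * u v) x)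
    by now apply continuous_mult_fun.
  exists u, (RInt (fun v => q v * u v) a).
  split; [assumption|]. split; [assumption|]. split; [|split].
  - intros t ht.
    apply (is_derive_ext_loc (fun x =>
      1 + RInt (fun s => r s * RInt (fun v => q v * u v) a s) a x)).
    + assert (hpos : 0 < t - a) by lra.
      exists (mkposreal _ hpos). intros x hx. rewrite (ufix x). unfold picard.
      rewrite Rmax_right; auto.
      apply Rabs_lt_between' in hx. simpl in hx. lra.
    + rewrite <- (Rplus_0_l (r t * _)).
      apply (is_derive_plus (fun _ => 1)
        (RInt (fun s => r s * RInt (fun v => q v * u v) a s) a)).
      * apply (is_derive_const (V := R_NormedModule)).
      * apply (is_derive_primitive (fun s => r s * _)).
        now apply continuous_picard_kernel.
  - intros t. apply (is_derive_primitive (fun v => q v * u v)). auto.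
  - intros t ht. apply RInt_gt_0; auto.
    intros x _. apply Rmult_lt_0_compat; auto. specialize (u1 x). lra.
Qed.

(** Reduction of order: [x = u (c - W)] with [W] the primitive of [r / u^2] and
    [c] its supremum on the half-line, which exists and is never attained.  That
    the quasi-derivative [y (c - W) - 1 / u] is at most zero is the tail bound
    [c - W t <= / (y t * u t)]. *)
Lemma decreasing_solution (r q : R -> R) (a K : R) :
  (forall x, continuous r x) -> (forall x, continuous q x) ->
  (forall x, 0 < r x) -> (forall x, 0 < q x) ->
  0 < K -> (forall t, a <= t -> RInt q a t <= K) ->
  exists x z : R -> R, forall t, a < t ->
    is_derive x t (r t * z t) /\ is_derive z t (q t * x t) /\
    0 < x t /\ z t <= 0.
Proof.
  intros hr hq pr pq hK hQ.
  destruct (growing_solution r q a K) as [u [y [uc [u1 [du [dy py]]]]]]; auto.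
  assert (pu : forall t, 0 < u t) by (intros t; specialize (u1 t); lra).
  assert (y_incr : forall s t, a < s -> s <= t -> y s <= y t).
  { intros s t hs hst.
    enough (0 - 0 <= y t - y s) by lra.
    apply (increment_le (fun _ => 0) y (fun _ => 0) (fun x => q x * u x)); auto.
    - intros x _. apply (is_derive_const (V := R_NormedModule)).
    - intros x _. apply Rlt_le, Rmult_lt_0_compat; auto. }
  set (w := fun s => r s / (u s * u s)).
  assert (wc : forall s, continuous w s).
  { intros s. apply continuous_mult_fun; auto. intros v.
    apply (continuous_comp (fun v => u v * u v) Rinv).
    - now apply continuous_mult_fun.
    - apply continuous_Rinv. apply Rgt_not_eq, Rmult_lt_0_compat; auto. }
  assert (pw : forall s, 0 < w s).
  { intros s. apply Rdiv_lt_0_compat; auto. apply Rmult_lt_0_compat; auto. }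
  set (W := RInt w a).
  assert (dW : forall t, is_derive W t (w t))
    by (intros t; now apply is_derive_primitive).
  (* [w = r/u^2] is compared with the derivative [r y / (y(t) u^2)] of
     [- 1/(y(t) u)], using [y(t) <= y]. *)
  assert (W_tail : forall t s, a < t -> t <= s -> W s - W t <= / (y t * u t)).
  { intros t s ht hts. assert (hy := py t ht).
    apply Rle_trans with (- / (y t * u s) - - / (y t * u t)).
    - apply (increment_le W (fun v => - / (y t * u v)) w
        (fun v => r v * y v / (y t * (u v * u v)))); auto.
      + intros v hv. assert (h := du v ltac:(lra)).
        assert (hne : y t * u v <> 0)
          by (apply Rgt_not_eq, Rmult_lt_0_compat; auto).
        specialize (pu v).
        auto_derive.
        * repeat split; auto. now exists (r v * y v).
        * apply is_derive_unique in h.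
          change (Derive (fun x : R => u x) v = r v * y v) in h.
          rewrite h. field. lra.
      + intros v hv. unfold w.
        replace (r v * y v / (y t * (u v * u v)))
          with (r v / (u v * u v) * (y v / y t))
          by (field; specialize (pu v); lra).
        rewrite <- (Rmult_1_r (r v / (u v * u v))) at 1.
        apply Rmult_le_compat_l; [apply Rlt_le, pw|].
        apply Rle_div_r; auto. rewrite Rmult_1_l. apply y_incr; lra.
    - assert (0 < / (y t * u s))
        by (apply Rinv_0_lt_compat, Rmult_lt_0_compat; auto).
      lra. }
  assert (W_incr : forall t s, t < s -> W t < W s).
  { intros t s hts. unfold W.
    rewrite <- (RInt_Chasles w a t s) by now apply ex_RInt_of_continuous.
    assert (0 < RInt w t s) by (apply RInt_gt_0; auto).
    unfold plus; simpl. lra. }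
  destruct (completeness (fun m => exists t, a < t /\ m = W t)) as [c [c_ub c_lub]].
  - exists (W (a + 1) + / (y (a + 1) * u (a + 1))). intros m [t [ht ->]].
    destruct (Rle_or_lt (a + 1) t) as [h|h].
    + assert (h' := W_tail (a + 1) t ltac:(lra) h). lra.
    + specialize (W_incr t (a + 1) h).
      assert (0 < / (y (a + 1) * u (a + 1))).
      { apply Rinv_0_lt_compat, Rmult_lt_0_compat; auto. apply py; lra. }
      lra.
  - exists (W (a + 1)), (a + 1). split; auto; lra.
  - assert (W_lt : forall t, a < t -> W t < c).
    { intros t ht. apply Rlt_le_trans with (W (t + 1)).
      - apply W_incr; lra.
      - apply c_ub. exists (t + 1). split; auto; lra. }
    assert (c_le : forall t, a < t -> c <= W t + / (y t * u t)).
    { intros t ht. apply c_lub. intros m [s [hs ->]].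
      destruct (Rle_or_lt t s) as [h|h].
      - specialize (W_tail t s ht h). lra.
      - specialize (W_incr s t h).
        assert (0 < / (y t * u t))
          by (apply Rinv_0_lt_compat, Rmult_lt_0_compat; auto).
        lra. }
    exists (fun t => u t * (c - W t)), (fun t => y t * (c - W t) - / u t).
    intros t ht. specialize (W_lt t ht). specialize (c_le t ht).
    assert (hu := pu t). assert (hy := py t ht).
    assert (h1 := du t ht). assert (h2 := dy t). assert (h3 := dW t).
    assert (e1 : Derive (fun x : R => u x) t = r t * y t)
      by now apply is_derive_unique.
    assert (e2 : Derive (fun x : R => y x) t = q t * u t)
      by now apply is_derive_unique.
    assert (e3 : Derive (fun x : R => W x) t = w t)
      by now apply is_derive_unique.
    clearbody W.
    split; [|split; [|split]].
    + auto_derive.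
      * repeat split; eexists; eassumption.
      * rewrite e1, e3. unfold w. field. lra.
    + auto_derive.
      * repeat split; try (eexists; eassumption). lra.
      * rewrite e1, e2, e3. unfold w. field. lra.
    + apply Rmult_lt_0_compat; lra.
    + assert (y t * (c - W t) <= y t * / (y t * u t))
        by (apply Rmult_le_compat_l; lra).
      replace (y t * / (y t * u t)) with (/ u t) in H by (field; lra). lra.
Qed.

(** * Decay of positive decreasing solutions *)

Lemma is_lim_p_infty_exists (f : R -> R) (M T : R) :
  is_lim f p_infty p_infty -> exists t, T <= t /\ M < f t.
Proof.
  intros hf. apply is_lim_spec in hf. destruct (hf M) as [t0 h].
  exists (Rmax T (t0 + 1)). split; [apply Rmax_l|].
  apply h. assert (h' := Rmax_r T (t0 + 1)). lra.
Qed.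

Lemma is_lim_0_of_decreasing (f : R -> R) (T : R) :
  (forall t, T <= t -> 0 <= f t) ->
  (forall s t, T <= s -> s <= t -> f t <= f s) ->
  (forall eps, 0 < eps -> exists t, T <= t /\ f t < eps) ->
  is_lim f p_infty 0.
Proof.
  intros hpos hdec hsmall. apply is_lim_spec. intros eps.
  destruct (hsmall eps (cond_pos eps)) as [t0 [ht0 h]].
  exists t0. intros t ht.
  specialize (hpos t ltac:(lra)). specialize (hdec t0 t ht0 ltac:(lra)).
  rewrite Rminus_0_r, Rabs_pos_eq; lra.
Qed.

Lemma primitive_le_lim (q : R -> R) (a l t : R) :
  (forall x, continuous q x) -> (forall x, 0 < q x) ->
  is_lim (RInt q a) p_infty l -> RInt q a t <= l.
Proof.
  intros hq pq hl.
  apply (is_lim_le_loc (fun _ => RInt q a t) (RInt q a) p_infty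
           (Finite (RInt q a t)) (Finite l)); auto.
  - exists t. intros s hs. apply primitive_incr; auto; [|lra].
    intros; now apply Rlt_le.
  - apply is_lim_const.
Qed.

(** Both limits are shown by contradiction: a positive lower bound for [- z],
    respectively for [x], makes [x] decrease at least like a multiple of
    the primitive of [r], respectively of [r (l - Q)], and so become negative. *)
Lemma decreasing_solution_decays (r q x z : R -> R) (a T l : R) :
  (forall t, continuous r t) -> (forall t, continuous q t) ->
  (forall t, 0 < r t) -> (forall t, 0 < q t) ->
  is_lim (RInt q a) p_infty l ->
  is_lim (RInt r a) p_infty p_infty ->
  is_lim (RInt (fun s => r s * (l - RInt q a s)) a) p_infty p_infty ->
  (forall t, T <= t -> is_derive x t (r t * z t)) ->
  (forall t, T <= t -> is_derive z t (q t * x t)) ->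
  (forall t, T <= t -> 0 < x t) -> (forall t, T <= t -> z t <= 0) ->
  is_lim x p_infty 0 /\ is_lim z p_infty 0.
Proof.
  intros hr hq pr pq hl hP hG dx dz px nz. split.
  - apply is_lim_0_of_decreasing with T.
    + intros t ht. now apply Rlt_le, px.
    + intros s t hs hst. enough (x t - x s <= 0 - 0) by lra.
      apply (increment_le x (fun _ => 0) (fun v => r v * z v) (fun _ => 0)); auto.
      * intros v hv. apply dx; lra.
      * intros v _. apply (is_derive_const (V := R_NormedModule)).
      * intros v hv. specialize (nz v ltac:(lra)). specialize (pr v).
        assert (0 <= r v * - z v) by (apply Rmult_le_pos; lra). lra.
    + intros eps heps. apply Classical_Prop.NNPP. intros hno.
      assert (xge : forall t, T <= t -> eps <= x t).
      { intros t ht. apply Rnot_lt_le. intros h. apply hno. now exists t. }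
      (* Integrate [z' = q x >= eps q] from [t] to [s], drop [z s <= 0], and let
         [s] tend to infinity. *)
      assert (zle : forall t, T <= t -> z t <= - eps * (l - RInt q a t)).
      { intros t ht.
        apply (is_lim_le_loc (fun _ => z t)
          (fun s => - eps * (RInt q a s - RInt q a t)) p_infty
          (Finite (z t)) (Finite (- eps * (l - RInt q a t)))).
        - exists t. intros s hs.
          assert (h := increment_le (fun v => eps * RInt q a v) z
            (fun v => eps * q v) (fun v => q v * x v) t s ltac:(lra)).
          specialize (nz s ltac:(lra)).
          enough (eps * RInt q a s - eps * RInt q a t <= z s - z t) by lra.
          apply h.
          + intros v _. apply (is_derive_scal (RInt q a)).
            now apply is_derive_primitive.
          + intros v hv. apply dz; lra.
          + intros v hv. rewrite Rmult_comm. apply Rmult_le_compat_l.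
            * now apply Rlt_le.
            * apply xge; lra.
        - apply is_lim_const.
        - apply (is_lim_scal_l (fun s => RInt q a s - RInt q a t) (- eps) p_infty
                   (Finite (l - RInt q a t))).
          apply (is_lim_minus (RInt q a) (fun _ => RInt q a t) p_infty
                   (Finite l) (Finite (RInt q a t))); auto.
          + apply is_lim_const.
          + reflexivity. }
      set (g := fun s => r s * (l - RInt q a s)) in *.
      assert (gc : forall s, continuous g s).
      { apply continuous_mult_fun; auto. intros s.
        apply (continuous_minus (fun _ => l) (RInt q a)).
        - apply continuous_const.
        - now apply continuous_primitive. }
      destruct (is_lim_p_infty_exists _ (x T / eps + RInt g a T) T hG)
        as [t [ht hbig]].
      assert (h : x t - x T <= - eps * RInt g a t - - eps * RInt g a T).
      { apply (increment_le x (fun v => - eps * RInt g a v) (fun v => r v * z v)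
          (fun v => - eps * g v)); auto.
        - intros v hv. apply dx; lra.
        - intros v _. apply (is_derive_scal (RInt g a)).
          now apply is_derive_primitive.
        - intros v hv. unfold g.
          replace (- eps * (r v * (l - RInt q a v)))
            with (r v * (- eps * (l - RInt q a v))) by ring.
          apply Rmult_le_compat_l; [now apply Rlt_le|]. apply zle; lra. }
      specialize (px t ht).
      assert (x T < eps * (RInt g a t - RInt g a T)).
      { rewrite Rmult_comm. apply Rlt_div_l; auto. lra. }
      lra.
  - apply (is_lim_ext (fun t => - (- z t))); [intros; ring|].
    replace (Finite 0) with (Rbar_opp 0) by (simpl; f_equal; ring).
    apply is_lim_opp. apply is_lim_0_of_decreasing with T.
    + intros t ht. specialize (nz t ht). lra.
    + intros s t hs hst. enough (0 - 0 <= z t - z s) by lra.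
      apply (increment_le (fun _ => 0) z (fun _ => 0) (fun v => q v * x v)); auto.
      * intros v _. apply (is_derive_const (V := R_NormedModule)).
      * intros v hv. apply dz; lra.
      * intros v hv. apply Rlt_le, Rmult_lt_0_compat; auto. apply px; lra.
    + intros eps heps. apply Classical_Prop.NNPP. intros hno.
      assert (zle : forall t, T <= t -> z t <= - eps).
      { intros t ht. apply Rnot_lt_le. intros h. apply hno. exists t.
        split; auto; lra. }
      destruct (is_lim_p_infty_exists _ (x T / eps + RInt r a T) T hP)
        as [t [ht hbig]].
      assert (h : x t - x T <= - eps * RInt r a t - - eps * RInt r a T).
      { apply (increment_le x (fun v => - eps * RInt r a v) (fun v => r v * z v)
          (fun v => - eps * r v)); auto.
        - intros v hv. apply dx; lra.
        - intros v _. apply (is_derive_scal (RInt r a)).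
          now apply is_derive_primitive.
        - intros v hv. rewrite (Rmult_comm (- eps)).
          apply Rmult_le_compat_l; [now apply Rlt_le|]. apply zle; lra. }
      specialize (px t ht).
      assert (x T < eps * (RInt r a t - RInt r a T)).
      { rewrite Rmult_comm. apply Rlt_div_l; auto. lra. }
      lra.
Qed.

(** * Equivalence of the two divergence conditions *)

Lemma primitive_by_parts (r q : R -> R) (a l t : R) :
  (forall t, continuous r t) -> (forall t, continuous q t) ->
  RInt (fun s => q s * RInt r a s) a t =
  RInt (fun s => r s * (l - RInt q a s)) a t - (l - RInt q a t) * RInt r a t.
Proof.
  intros hr hq.
  assert (hc : forall s, continuous (fun s => r s * (l - RInt q a s)) s).
  { apply continuous_mult_fun; auto. intros s.
    apply (continuous_minus (fun _ => l) (RInt q a)).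
    - apply continuous_const.
    - now apply continuous_primitive. }
  assert (hc' : forall s, continuous (fun s => q s * RInt r a s) s).
  { apply continuous_mult_fun; auto. intros s. now apply continuous_primitive. }
  set (Gf := fun s => r s * (l - RInt q a s)) in *.
  set (F := fun t => RInt Gf a t - (l - RInt q a t) * RInt r a t).
  replace (_ - _) with (F t - F a) by
    (unfold F; rewrite (primitive_point Gf), (primitive_point r); ring).
  apply is_RInt_unique, (is_RInt_derive F).
  - intros s _.
    assert (h1 := is_derive_primitive Gf a s hc).
    assert (h2 := is_derive_primitive q a s hq).
    assert (h3 := is_derive_primitive r a s hr).
    unfold F.
    replace (q s * RInt r a s)
      with (Gf s - ((0 - q s) * RInt r a s + (l - RInt q a s) * r s))
      by (unfold Gf; ring).
    apply (is_derive_minus (RInt Gf a) (fun t => (l - RInt q a t) * RInt r a t)); auto.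
    apply (is_derive_mult (fun t => l - RInt q a t) (RInt r a)); auto.
    + apply (is_derive_minus (fun _ => l) (RInt q a)); auto.
      apply (is_derive_const (V := R_NormedModule)).
    + intros; apply Rmult_comm.
  - auto.
Qed.

(** The boundary term [(l - Q t) * P t] of the integration by parts need not be
    small.  It has the right sign for one implication; for the other it is
    recovered from the growth of [int q P] beyond [t], where [P >= P t]. *)
Lemma divergence_equivalence (r q : R -> R) (a l : R) :
  (forall t, continuous r t) -> (forall t, continuous q t) ->
  (forall t, 0 < r t) -> (forall t, 0 < q t) ->
  is_lim (RInt q a) p_infty l ->
  is_lim (RInt (fun s => q s * RInt r a s) a) p_infty p_infty <->
  is_lim (RInt (fun s => r s * (l - RInt q a s)) a) p_infty p_infty.
Proof.
  intros hr hq pr pq hl.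
  assert (Ppos : forall t, a <= t -> 0 <= RInt r a t).
  { intros t ht. rewrite <- (primitive_point r a).
    apply primitive_incr; auto. intros; now apply Rlt_le. }
  split; intros H; apply is_lim_spec; intros M.
  - apply is_lim_spec in H. destruct (H M) as [t0 h0].
    exists (Rmax t0 a). intros t ht.
    assert (h1 := Rmax_l t0 a). assert (h2 := Rmax_r t0 a).
    specialize (h0 t ltac:(lra)).
    rewrite (primitive_by_parts r q a l t) in h0 by auto.
    assert (0 <= (l - RInt q a t) * RInt r a t); [|lra].
    apply Rmult_le_pos; [|apply Ppos; lra].
    assert (h := primitive_le_lim q a l t hq pq hl). lra.
  - destruct (is_lim_p_infty_exists _ (M + 1) a H) as [t [ht hbig]].
    assert (hP := Ppos t ht).
    (* The 1 in the denominator covers the case [t = a], where [P] vanishes. *)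
    assert (heps : 0 < / (RInt r a t + 1)) by (apply Rinv_0_lt_compat; lra).
    apply is_lim_spec in hl. destruct (hl (mkposreal _ heps)) as [s0 hs0].
    exists (Rmax s0 t). intros s hs.
    assert (h1 := Rmax_l s0 t). assert (h2 := Rmax_r s0 t).
    specialize (hs0 s ltac:(lra)). simpl in hs0. apply Rabs_def2 in hs0.
    assert (hsmall : RInt r a t * (l - RInt q a s) < 1).
    { apply Rle_lt_trans with (RInt r a t * / (RInt r a t + 1)).
      - apply Rmult_le_compat_l; lra.
      - apply (Rlt_div_l (RInt r a t)); lra. }
    assert (hparts := primitive_by_parts r q a l t hr hq).
    assert (h : RInt r a t * RInt q a s - RInt r a t * RInt q a t <=
      RInt (fun s => q s * RInt r a s) a s - RInt (fun s => q s * RInt r a s) a t).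
    { apply (increment_le (fun v => RInt r a t * RInt q a v)
        (RInt (fun s => q s * RInt r a s) a)
        (fun v => RInt r a t * q v) (fun s => q s * RInt r a s)); [lra| | |].
      - intros v _. apply (is_derive_scal (RInt q a)).
        now apply is_derive_primitive.
      - intros v _. apply (is_derive_primitive (fun s => q s * RInt r a s)).
        apply continuous_mult_fun; auto.
        intros x. now apply continuous_primitive.
      - intros v hv. rewrite Rmult_comm. apply Rmult_le_compat_l.
        + now apply Rlt_le.
        + apply primitive_incr; auto; [intros; now apply Rlt_le | lra]. }
    lra.
Qed.

(** * Transfer to coefficients given on a half-line *)

Lemma RInt_agree_on_ray (f g : R -> R) (a t : R) :
  (forall s, a <= s -> f s = g s) -> a <= t -> RInt f a t = RInt g a t.
Proof.
  intros hfg ht. apply (RInt_ext f g). intros s hs.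
  rewrite Rmin_left in hs by assumption. apply hfg; lra.
Qed.

Lemma RInt_infinite_agree_on_ray (f g : R -> R) (a : R) :
  (forall s, a <= s -> f s = g s) ->
  RInt_infinite f a <-> is_lim (RInt g a) p_infty p_infty.
Proof.
  intros hfg. unfold RInt_infinite.
  split; apply is_lim_ext_loc; exists a; intros t ht; [|symmetry];
    apply RInt_agree_on_ray; auto; lra.
Qed.

Lemma is_lim_of_is_RInt_gen (f : R -> R) (a l : R) :
  is_RInt_gen f (at_point a) (Rbar_locally p_infty) l ->
  is_lim (RInt f a) p_infty l.
Proof.
  intros hf P hP. destruct (hf P hP) as [Q1 Q2 h1 [M hM] h].
  exists M. intros t ht. destruct (h a t h1 (hM t ht)) as [v [hv hPv]]. simpl in hv.
  now rewrite (is_RInt_unique _ _ _ _ hv).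
Qed.

Lemma rho_eq (q : R -> R) (a l t : R) :
  is_RInt_gen q (at_point a) (Rbar_locally p_infty) l ->
  ex_RInt q a t -> rho q t = l - RInt q a t.
Proof.
  intros hl ht. unfold rho, RInt_infty.
  apply is_RInt_gen_unique; try apply Proper_StrongProper;
    try apply at_point_filter; try apply Rbar_locally_filter.
  replace (l - RInt q a t) with (plus (opp (RInt q a t)) l)
    by (unfold plus, opp; simpl; ring).
  apply (is_RInt_gen_Chasles q a); auto.
  apply is_RInt_gen_at_point. apply (is_RInt_swap q).
  now apply (RInt_correct q).
Qed.

(** Properness holds at the end point [T] too, since [T] itself lies on the
    ray. *)
Lemma within_ray_proper (T t : R) :
  T <= t -> ProperFilter (within (ray T) (locally t)).
Proof.
  intros ht. constructor.
  - intros P hP. exists t. apply (locally_singleton t _ hP ht).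
  - apply within_filter, locally_filter.
Qed.

Lemma derive_on_ray_of_is_derive (T : R) (f df : R -> R) :
  (forall t, T <= t -> is_derive f t (df t)) -> derive_on_ray T f df.
Proof.
  intros hf t ht.
  apply (filterdiff_locally (FF := within_ray_proper T t ht) f t).
  - intros P hP. unfold within. revert hP. apply filter_imp. auto.
  - now apply hf.
Qed.

Theorem theorem4p3 (a : R) (p q : R -> R)
  (ha : 0 <= a)
  (hpc : continuous_on (ray a) p)
  (hqc : continuous_on (ray a) q)
  (hp : forall t, a <= t -> 0 < p t)
  (hq : forall t, a <= t -> 0 < q t)
  (hpinf : RInt_infinite (fun t => / p t) a)
  (hqfin : ex_RInt_infty q a) :
  (RInt_infinite (fun t => q t * Pfun p a t) a <->
   RInt_infinite (fun t => rho q t / p t) a) /\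
  (RInt_infinite (fun t => q t * Pfun p a t) a ->
   forall delta : R, 0 < delta < 1 ->
   Rbar_locally p_infty (fun t =>
     ex_RInt_infty (fun s => rho q s ^ 2 / p s) t /\
     RInt_infty (fun s => rho q s ^ 2 / p s) t <= delta * rho q t) ->
   exists (T : R) (x dx : R -> R),
     a <= T /\
     is_solution p q T x dx /\
     (forall t, T <= t -> 0 < x t) /\
     is_decaying_extreme p x dx).
Proof.
  set (r := fun t => / p (Rmax a t)).
  set (q' := fun t => q (Rmax a t)).
  assert (rE : forall t, a <= t -> / p t = r t)
    by (intros t ht; unfold r; now rewrite Rmax_right).
  assert (qE : forall t, a <= t -> q t = q' t)
    by (intros t ht; unfold q'; now rewrite Rmax_right).
  assert (pr : forall t, 0 < r t)
    by (intros t; apply Rinv_0_lt_compat, hp, Rmax_l).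
  assert (pq : forall t, 0 < q' t) by (intros t; apply hq, Rmax_l).
  assert (qc : forall t, continuous q' t) by now apply continuous_clamp.
  assert (rc : forall t, continuous r t).
  { intros t. apply (continuous_comp (fun s => p (Rmax a s)) Rinv).
    - now apply continuous_clamp.
    - apply continuous_Rinv, Rgt_not_eq, hp, Rmax_l. }
  destruct hqfin as [l hl].
  assert (hlim : is_lim (RInt q' a) p_infty l).
  { apply (is_lim_ext_loc (RInt q a)).
    - exists a. intros t ht. apply RInt_agree_on_ray; auto; lra.
    - now apply is_lim_of_is_RInt_gen. }
  assert (rhoE : forall t, a <= t -> rho q t = l - RInt q' a t).
  { intros t ht. rewrite <- (RInt_agree_on_ray q q' a t qE ht).
    apply rho_eq; auto. apply (ex_RInt_ext q').
    - intros s hs. rewrite Rmin_left in hs by assumption. symmetry. apply qE; lra.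
    - now apply ex_RInt_of_continuous. }
  apply (RInt_infinite_agree_on_ray _ r a rE) in hpinf.
  assert (hH := RInt_infinite_agree_on_ray (fun t => q t * Pfun p a t)
    (fun s => q' s * RInt r a s) a).
  assert (hG := RInt_infinite_agree_on_ray (fun t => rho q t / p t)
    (fun s => r s * (l - RInt q' a s)) a).
  rewrite hH, hG.
  - assert (heq := divergence_equivalence r q' a l rc qc pr pq hlim).
    split; [exact heq|].
    intros hdiv _ _ _. apply heq in hdiv.
    assert (hl_pos : 0 < l).
    { apply Rlt_le_trans with (RInt q' a (a + 1)).
      - apply RInt_gt_0; auto; lra.
      - now apply primitive_le_lim. }
    destruct (decreasing_solution r q' a l) as [x [z hxz]]; auto.
    { intros t _. now apply primitive_le_lim. }
    assert (quasiE : forall t, a < t ->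
      z t = quasi_derivative p (fun s => r s * z s) t).
    { intros t ht. unfold quasi_derivative. rewrite <- rE by lra.
      field. apply Rgt_not_eq, hp; lra. }
    destruct (decreasing_solution_decays r q' x z a (a + 1) l) as [x0 z0]; auto;
      try (intros t ht; apply hxz; lra).
    (* Starting at [a + 1] rather than [a] leaves room for two-sided derivatives
       at the initial point. *)
    exists (a + 1), x, (fun t => r t * z t).
    split; [lra|]. split; [split; [|split]|split; [|split]].
    + apply derive_on_ray_of_is_derive. intros t ht. apply hxz; lra.
    + apply derive_on_ray_of_is_derive. intros t ht.
      apply (is_derive_ext_loc z).
      * assert (hpos : 0 < t - a) by lra. exists (mkposreal _ hpos).
        intros s hs. apply quasiE. apply Rabs_lt_between' in hs. simpl in hs. lra.
      * rewrite qE by lra. apply hxz; lra.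
    + exists (a + 1). split; [lra|]. apply Rgt_not_eq, hxz; lra.
    + intros t ht. apply hxz; lra.
    + exact x0.
    + apply (is_lim_ext_loc z); auto. exists a. exact quasiE.
  - intros s hs. rewrite rhoE, <- rE by assumption. unfold Rdiv. ring.
  - intros s hs. rewrite qE by assumption. f_equal.
    now apply RInt_agree_on_ray.
Qed.
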